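(* Fix $q\in\,]0,1[$ and let $a<0<b$ be real numbers. Let $f:[a,b]\to\mathbb{R}$ be an absolutely $q$-integrable function on $[a,b]$, and suppose that there exist real numbers $m$ and $M$ such that $$m\le f(x)\le M\quad\text{for all }x\in[a,b]_q:=\{aq^n:n\in\mathbb{N}_0\}\cup\{bq^n:n\in\mathbb{N}_0\}\cup\{0\}.$$ If $u:[a,b]\to\mathbb{R}$ is $q$-$L$-Lipschitzian on $[a,b]_q$ and $\lim_{n\to\infty}u(q^nx)$ exists for $x=a$ and for $x=b$, then $$\left|\int_a^b f(x)\,d_q u(x)-\frac{u(b)-u(a)-\left(u(0^+)-u(0^-)\right)}{b-a}\int_a^b f(t)\,d_q t\right|\le\frac12 L(M-m)(b-a).$$ The constant $\frac12$ is the best possible: there is no constant $c<\frac12$ such that the inequality with $\frac12$ replaced by $c$ holds for all admissible data $(a,b,f,u,m,M,L)$.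
   Context: Here $0<q<1$. The Jackson $q$-integral is $\int_a^b h(x)\,d_qx:=\int_0^b h\,d_q-\int_0^a h\,d_q$ with $\int_0^x h\,d_q:=\sum_{k=0}^\infty (q^kx-q^{k+1}x)\,h(q^kx)$. The function $h$ is $q$-integrable on $[a,b]$ if these series converge for $x=a$ and $x=b$, and absolutely $q$-integrable if $|h|$ is $q$-integrable. The Riemann–Stieltjes $q$-integral with respect to $u$ is $$\int_a^b f(x)\,d_qu(x):=\sum_{k=0}^\infty f(q^kb)\big(u(q^kb)-u(q^{k+1}b)\big)-\sum_{k=0}^\infty f(q^ka)\big(u(q^ka)-u(q^{k+1}a)\big).$$ A real function $u$ is $q$-$L$-Lipschitzian on $[a,b]_q$ if $|u(x)-u(qx)|\le L|x-qx|$ for all $x\in[a,b]_q$. Notation: $u(0^+):=\lim_{n\to\infty}u(q^nb)$ and $u(0^-):=\lim_{n\to\infty}u(q^na)$. *)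

(* Defs.v *)
From Stdlib Require Import Reals.
From Coquelicot Require Import Coquelicot.
Open Scope R_scope.

(** Jackson and Riemann-Stieltjes q-integrals over Stdlib's [R], with
    Coquelicot's series.  Functions on [[a,b]] are represented by total
    functions [R -> R]; every notion below only evaluates them at points of the
    q-lattice [qlattice q a b], a subset of [[a,b]] when [0 < q < 1] and
    [a < 0 < b].  [Series] and [Lim_seq] are total: their values are meaningful
    only under the corresponding convergence predicates. *)

Definition jackson_term (q : R) (h : R -> R) (x : R) (k : nat) : R :=
  (q ^ k * x - q ^ (k + 1) * x) * h (q ^ k * x).

Definition jackson0 (q : R) (h : R -> R) (x : R) : R :=
  Series (jackson_term q h x).

Definition jackson (q : R) (h : R -> R) (a b : R) : R :=
  jackson0 q h b - jackson0 q h a.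

Definition q_integrable (q : R) (h : R -> R) (a b : R) : Prop :=
  ex_series (jackson_term q h a) /\ ex_series (jackson_term q h b).

Definition abs_q_integrable (q : R) (h : R -> R) (a b : R) : Prop :=
  q_integrable q (fun x => Rabs (h x)) a b.

Definition stieltjes_term (q : R) (f u : R -> R) (x : R) (k : nat) : R :=
  f (q ^ k * x) * (u (q ^ k * x) - u (q ^ (k + 1) * x)).

Definition q_stieltjes (q : R) (f u : R -> R) (a b : R) : R :=
  Series (stieltjes_term q f u b) - Series (stieltjes_term q f u a).

Definition q_stieltjes_integrable (q : R) (f u : R -> R) (a b : R) : Prop :=
  ex_series (stieltjes_term q f u a) /\ ex_series (stieltjes_term q f u b).

Definition qlattice (q a b x : R) : Prop :=
  (exists n : nat, x = a * q ^ n) \/ (exists n : nat, x = b * q ^ n) \/ x = 0.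

Definition q_lipschitzian (q L : R) (u : R -> R) (a b : R) : Prop :=
  forall x : R, qlattice q a b x ->
    Rabs (u x - u (q * x)) <= L * Rabs (x - q * x).

Definition ex_qlim (q : R) (u : R -> R) (x : R) : Prop :=
  ex_finite_lim_seq (fun n : nat => u (q ^ n * x)).

(** For [a < 0 < b], [qlim q u b] is u(0+) and [qlim q u a] is u(0-). *)
Definition qlim (q : R) (u : R -> R) (x : R) : R :=
  real (Lim_seq (fun n : nat => u (q ^ n * x))).

(* Main.v *)
Require Import Defs.
From Stdlib Require Import Reals Lra.
From Coquelicot Require Import Coquelicot.
Open Scope R_scope.

(** Let [mu] be the measure on the q-lattice giving the points [q^k b] and
    [q^k a] the masses [|q^k b - q^(k+1) b|] and [|q^k a - q^(k+1) a|]; its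
    total mass is [b - a].  With [g] the q-difference quotient of [u], so that
    [|g| <= L], and [F] the [mu]-average of [f], the quantity to bound is
    [int (f - F) g dmu], hence at most [L * int |f - F| dmu].  On [[m, M]] the
    convex function [|t - F|] lies below its chord, and integrating the chord
    gives [2 (M - F) (F - m) / (M - m) * (b - a) <= (M - m) / 2 * (b - a)].
    Equality holds for [u x = |x|] and [f] the indicator of [x > 0] on
    [[-1, 1]]. *)

(** * Real series: comparison and telescoping *)

(* Instances at [R] of Coquelicot's lemmas on normed modules: the goals they
   leave are then syntactically about [R], as [ring] and [apply] need. *)
Lemma is_series_Rext (s t : nat -> R) (S : R) :
  (forall k, s k = t k) -> is_series s S -> is_series t S.
Proof. exact (is_series_ext s t S). Qed.

Lemma is_series_Rscal (c : R) (s : nat -> R) (S : R) :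
  is_series s S -> is_series (fun k => c * s k) (c * S).
Proof. exact (is_series_scal c s S). Qed.

Lemma is_series_Rplus (s t : nat -> R) (S T : R) :
  is_series s S -> is_series t T -> is_series (fun k => s k + t k) (S + T).
Proof. exact (is_series_plus s t S T). Qed.

Lemma is_series_Rle (s t : nat -> R) (S T : R) :
  is_series s S -> is_series t T -> (forall k, s k <= t k) -> S <= T.
Proof.
intros hs ht hle.
apply (is_lim_seq_le (sum_n s) (sum_n t) S T); [|exact hs|exact ht].
intros n; apply sum_n_m_le; exact hle.
Qed.

Lemma is_series_Rabs_le (s t : nat -> R) (S T : R) :
  is_series s S -> is_series t T -> (forall k, Rabs (s k) <= t k) -> Rabs S <= T.
Proof.
intros hs ht hle.
apply Rabs_le; split.
- apply (is_series_Rle (fun k => - t k) s); [|exact hs|].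
  + exact (is_series_opp t T ht).
  + intros k; apply (Rabs_le_between (s k) (t k)), hle.
- apply (is_series_Rle s t); [exact hs|exact ht|].
  intros k; apply (Rabs_le_between (s k) (t k)), hle.
Qed.

Lemma is_series_telescope (v : nat -> R) (l : R) :
  is_lim_seq v l -> is_series (fun k => v k - v (k + 1)%nat) (v 0%nat - l).
Proof.
intros hv.
assert (hsum : forall n, sum_n (fun k => v k - v (k + 1)%nat) n = v 0%nat - v (S n)).
{ induction n as [|n IH].
  - now rewrite sum_O.
  - rewrite sum_Sn, IH, Nat.add_1_r; unfold plus; simpl; ring. }
change (is_lim_seq (sum_n (fun k => v k - v (k + 1)%nat)) (v 0%nat - l)).
apply (is_lim_seq_ext (fun n => v 0%nat - v (S n))).
- intros n; now rewrite hsum.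
- apply is_lim_seq_minus'; [apply is_lim_seq_const|].
  now apply is_lim_seq_incr_1 in hv.
Qed.

Lemma is_series_R0 : is_series (fun _ : nat => 0) 0.
Proof.
pose proof (is_series_telescope (fun _ => 0) 0 (is_lim_seq_const 0)) as h.
cbv beta in h; now rewrite Rminus_0_r in h.
Qed.

(** * The geometric orbit of a single endpoint [x], later taken to be [a] and [b] *)

Section OneSide.

Variables (q : R) (hq : 0 < q < 1) (x : R).

Lemma is_lim_seq_qpow : is_lim_seq (fun n => q ^ n * x) 0.
Proof.
replace (Finite 0) with (Rbar_mult 0 x) by (simpl; f_equal; ring).
apply is_lim_seq_scal_r, is_lim_seq_geom.
rewrite Rabs_pos_eq; lra.
Qed.

Lemma is_series_qstep : is_series (fun k => q ^ k * x - q ^ (k + 1) * x) x.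
Proof.
pose proof (is_series_telescope (fun n => q ^ n * x) 0 is_lim_seq_qpow) as h.
cbv beta in h; now replace (q ^ 0 * x - 0) with x in h by (simpl; ring).
Qed.

Lemma is_series_qdiff (u : R -> R) :
  ex_qlim q u x ->
  is_series (fun k => u (q ^ k * x) - u (q ^ (k + 1) * x)) (u x - qlim q u x).
Proof.
intros h.
pose proof (is_series_telescope (fun n => u (q ^ n * x)) _ (Lim_seq_correct' _ h)) as hs.
cbv beta in hs; now replace (q ^ 0 * x) with x in hs by (simpl; ring).
Qed.

Lemma Rabs_qstep (k : nat) :
  Rabs (q ^ k * x - q ^ (k + 1) * x) = (q ^ k - q ^ (k + 1)) * Rabs x.
Proof.
rewrite <- Rmult_minus_distr_r, Rabs_mult.
f_equal; apply Rabs_pos_eq.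
pose proof (pow_lt q k (proj1 hq)).
rewrite pow_add, pow_1; nra.
Qed.

(* [e] is the sign of [x]; it turns the signed masses of the Jackson sum into
   positive ones. *)
Variables (e : R) (he : Rabs x = e * x) (f : R -> R).
Hypothesis hf : ex_series (jackson_term q (fun y => Rabs (f y)) x).

Lemma ex_series_abs_jackson : ex_series (fun k => Rabs (jackson_term q f x k)).
Proof.
destruct hf as [S hS]; exists (e * S).
apply (is_series_Rext (fun k => e * jackson_term q (fun y => Rabs (f y)) x k)).
- intros k; unfold jackson_term.
  rewrite Rabs_mult, Rabs_qstep, he; ring.
- now apply is_series_Rscal.
Qed.

Lemma is_series_jackson : is_series (jackson_term q f x) (jackson0 q f x).
Proof. exact (Series_correct _ (ex_series_Rabs _ ex_series_abs_jackson)). Qed.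

(** This integrates [al * f + be] against the positive measure on one side of 0; the constant
    contributes [be * Rabs x], since [e * x] is the mass of that side. *)
Lemma is_series_affine (al be : R) :
  is_series (fun k => Rabs (q ^ k * x - q ^ (k + 1) * x) * (al * f (q ^ k * x) + be))
    (e * (al * jackson0 q f x + be * x)).
Proof.
apply (is_series_Rext (fun k => e * (al * jackson_term q f x k
                                    + be * (q ^ k * x - q ^ (k + 1) * x)))).
- intros k; unfold jackson_term; rewrite Rabs_qstep, he; ring.
- apply (is_series_Rscal e); apply is_series_Rplus.
  + apply (is_series_Rscal al), is_series_jackson.
  + apply (is_series_Rscal be), is_series_qstep.
Qed.

(** Serves to place the mean of [f] between [m] and [M], through the nonnegative functions [f - m]
    and [M - f]. *)
Lemma jackson_affine_ge0 (al be : R) :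
  (forall k, 0 <= al * f (q ^ k * x) + be) ->
  0 <= e * (al * jackson0 q f x + be * x).
Proof.
intros h.
(* Nonnegativity is read as domination of the zero series. *)
apply (Rle_trans _ _ _ (Rabs_pos 0)).
apply (is_series_Rabs_le (fun _ => 0) _ 0 _) with (2 := is_series_affine al be).
- exact is_series_R0.
- intros k; rewrite Rabs_R0; apply Rmult_le_pos; [apply Rabs_pos|apply h].
Qed.

Variables (u : R -> R) (L : R).
Hypothesis hu :
  forall k, Rabs (u (q ^ k * x) - u (q ^ (k + 1) * x))
            <= L * Rabs (q ^ k * x - q ^ (k + 1) * x).

(** Comparison with the absolutely convergent Jackson series, as each increment of [u] is at most
    [L] times the mass of its point. *)
Lemma ex_series_stieltjes : ex_series (stieltjes_term q f u x).
Proof.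
apply (ex_series_le (stieltjes_term q f u x) (fun k => L * Rabs (jackson_term q f x k))).
- intros k; unfold stieltjes_term, jackson_term, norm; simpl; unfold abs; simpl.
  rewrite !Rabs_mult.
  pose proof (Rmult_le_compat_l _ _ _ (Rabs_pos (f (q ^ k * x))) (hu k)).
  lra.
- exact (ex_series_scal L _ ex_series_abs_jackson).
Qed.

(** The increments of [u] telescope to [u x - qlim q u x], so subtracting [F] times this total
    replaces [f] by [f - F] under the sum. The Lipschitz bound then trades increments for masses,
    and the affine majorant can be summed exactly. *)
Lemma stieltjes_affine_bound (F al be : R) :
  ex_qlim q u x -> 0 <= L ->
  (forall k, Rabs (f (q ^ k * x) - F) <= al * f (q ^ k * x) + be) ->
  Rabs (Series (stieltjes_term q f u x) - F * (u x - qlim q u x))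
    <= L * (e * (al * jackson0 q f x + be * x)).
Proof.
intros hlim hL h.
apply (is_series_Rabs_le
  (fun k => (f (q ^ k * x) - F) * (u (q ^ k * x) - u (q ^ (k + 1) * x)))
  (fun k => L * (Rabs (q ^ k * x - q ^ (k + 1) * x) * (al * f (q ^ k * x) + be)))).
- apply (is_series_Rext (fun k => stieltjes_term q f u x k
            + - F * (u (q ^ k * x) - u (q ^ (k + 1) * x)))).
  + intros k; unfold stieltjes_term; ring.
  + unfold Rminus at 2; rewrite Ropp_mult_distr_l; apply is_series_Rplus.
    * apply Series_correct, ex_series_stieltjes.
    * apply (is_series_Rscal (- F)), is_series_qdiff, hlim.
- apply (is_series_Rscal L), is_series_affine.
- intros k; rewrite Rabs_mult.
  apply Rle_trans with ((al * f (q ^ k * x) + be)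
                        * (L * Rabs (q ^ k * x - q ^ (k + 1) * x))); [|lra].
  apply Rmult_le_compat; auto using Rabs_pos.
Qed.

End OneSide.

(** * The chord majorant of the distance to [F] *)

(* The right-hand side is the chord of [|t - F|] over [[m, M]]; for [m = M] it
   is [0] because Rocq's division by [0] gives [0]. *)
Lemma Rabs_chord_le (m M F t : R) :
  m <= F <= M -> m <= t <= M ->
  Rabs (t - F) <= (M + m - 2 * F) / (M - m) * t + (F * (M + m) - 2 * m * M) / (M - m).
Proof.
intros hF ht.
destruct (Req_dec m M) as [->|hne].
- replace t with M by lra; replace F with M by lra.
  unfold Rdiv; rewrite Rminus_diag, Rinv_0, Rabs_R0; lra.
- replace (_ / _ * t + _) with
    (((M - t) * (F - m) + (t - m) * (M - F)) / (M - m)) by (field; lra).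
  apply Rle_div_r; [lra|].
  unfold Rabs; destruct Rcase_abs; nra.
Qed.

(** At [F] the chord has height [2 * (M - F) * (F - m) / (M - m)], and the product is largest at the
    midpoint of [m] and [M]. *)
Lemma chord_at_mean_le (m M F : R) :
  m <= F <= M ->
  (M + m - 2 * F) / (M - m) * F + (F * (M + m) - 2 * m * M) / (M - m) <= (M - m) / 2.
Proof.
intros hF.
destruct (Req_dec m M) as [->|hne].
- unfold Rdiv; rewrite Rminus_diag, Rinv_0; lra.
- replace (_ / _ * F + _) with (2 * (M - F) * (F - m) / (M - m)) by (field; lra).
  apply Rle_div_l; [lra|].
  (* This square equals [(M - m)^2 - 4 * (M - F) * (F - m)]. *)
  pose proof (pow2_ge_0 (M + m - 2 * F)); nra.
Qed.

(** * The inequality, by adding the two sides of 0 *)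

Lemma q_gruss (q a b : R) (f u : R -> R) (m M L : R) :
  0 < q < 1 -> a < 0 < b ->
  abs_q_integrable q f a b ->
  (forall x : R, qlattice q a b x -> m <= f x <= M) ->
  q_lipschitzian q L u a b ->
  ex_qlim q u a ->
  ex_qlim q u b ->
  q_stieltjes_integrable q f u a b /\
  Rabs (q_stieltjes q f u a b
        - (u b - u a - (qlim q u b - qlim q u a)) / (b - a) * jackson q f a b)
    <= 1 / 2 * L * (M - m) * (b - a).
Proof.
intros hq hab [hfa hfb] hf hu hla hlb.
assert (la : forall k, qlattice q a b (q ^ k * a))
  by (intros k; left; exists k; ring).
assert (lb : forall k, qlattice q a b (q ^ k * b))
  by (intros k; right; left; exists k; ring).
assert (ea : Rabs a = - (1) * a) by (rewrite Rabs_left; lra).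
assert (eb : Rabs b = 1 * b) by (rewrite Rabs_pos_eq; lra).
assert (step : forall k x, q * (q ^ k * x) = q ^ (k + 1) * x)
  by (intros k x; rewrite pow_add; ring).
assert (ha : forall k, Rabs (u (q ^ k * a) - u (q ^ (k + 1) * a))
                       <= L * Rabs (q ^ k * a - q ^ (k + 1) * a))
  by (intros k; rewrite <- step; exact (hu _ (la k))).
assert (hb : forall k, Rabs (u (q ^ k * b) - u (q ^ (k + 1) * b))
                       <= L * Rabs (q ^ k * b - q ^ (k + 1) * b))
  by (intros k; rewrite <- step; exact (hu _ (lb k))).
(* The Lipschitz condition at [b] itself forces this sign, because the step [b - q * b] is
   positive. *)
assert (hL : 0 <= L).
{ pose proof (Rle_trans _ _ _ (Rabs_pos _) (hb 0%nat)) as h.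
  rewrite Rabs_qstep, eb in h by exact hq; simpl in h.
  assert (0 < (1 - q * 1) * (1 * b)) by nra; nra. }
split.
{ split; [apply (ex_series_stieltjes q hq a _ ea f hfa u L ha)
         |apply (ex_series_stieltjes q hq b _ eb f hfb u L hb)]. }
pose (F := jackson q f a b / (b - a)).
assert (hF : jackson q f a b = F * (b - a)) by (unfold F; field; lra).
(* Integrate [f - m] and [M - f] over each side; the sums of the two sides are [(F - m) * (b - a)]
   and [(M - F) * (b - a)]. *)
assert (hmM : m <= F <= M).
{ assert (h1 := jackson_affine_ge0 q hq a _ ea f hfa 1 (- m)).
  assert (h2 := jackson_affine_ge0 q hq b _ eb f hfb 1 (- m)).
  assert (h3 := jackson_affine_ge0 q hq a _ ea f hfa (- (1)) M).
  assert (h4 := jackson_affine_ge0 q hq b _ eb f hfb (- (1)) M).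
  unfold jackson in hF.
  split; apply (Rmult_le_reg_r (b - a)); try lra.
  - lapply h1; [lapply h2; [lra|]|]; intros k; [specialize (hf _ (lb k))|specialize (hf _ (la k))]; lra.
  - lapply h3; [lapply h4; [lra|]|]; intros k; [specialize (hf _ (lb k))|specialize (hf _ (la k))]; lra. }
set (al := (M + m - 2 * F) / (M - m)).
set (be := (F * (M + m) - 2 * m * M) / (M - m)).
assert (ba := stieltjes_affine_bound q hq a _ ea f hfa u L ha F al be hla hL
                (fun k => Rabs_chord_le m M F _ hmM (hf _ (la k)))).
assert (bb := stieltjes_affine_bound q hq b _ eb f hfb u L hb F al be hlb hL
                (fun k => Rabs_chord_le m M F _ hmM (hf _ (lb k)))).
assert (hc : al * F + be <= (M - m) / 2) by exact (chord_at_mean_le m M F hmM).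
apply Rle_trans with (L * ((al * F + be) * (b - a))).
(* An affine function of [f] has as its mean the same affine function of [F], so the two one-sided
   bounds add up to the chord at [F] times the total mass. *)
- replace (L * _) with (L * (1 * (al * jackson0 q f b + be * b))
                        + L * (- (1) * (al * jackson0 q f a + be * a))).
  2:{ unfold jackson in hF.
      replace (jackson0 q f b) with (F * (b - a) + jackson0 q f a) by lra; ring. }
  rewrite hF; unfold q_stieltjes.
  (* The factor [b - a] in the integral of [f] cancels the denominator, leaving [F] times the total
     increment of [u], which splits between the two sides. *)
  match goal with |- Rabs ?X <= _ => replace X with
    ((Series (stieltjes_term q f u b) - F * (u b - qlim q u b))
     - (Series (stieltjes_term q f u a) - F * (u a - qlim q u a))) by (field; lra) end.
  eapply Rle_trans; [apply Rabs_triang|].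
  rewrite Rabs_Ropp; lra.
- replace (1 / 2 * L * (M - m) * (b - a)) with (L * ((M - m) / 2 * (b - a))) by field.
  apply Rmult_le_compat_l; [exact hL|].
  apply Rmult_le_compat_r; lra.
Qed.

(** * Sharpness of the constant *)

Definition pos_indicator (x : R) : R := if Rlt_dec 0 x then 1 else 0.

Lemma pos_indicator_qpow (q : R) (k : nat) :
  0 < q -> pos_indicator (q ^ k * 1) = 1 /\ pos_indicator (q ^ k * -1) = 0.
Proof.
intros hq; pose proof (pow_lt q k hq).
unfold pos_indicator; split; destruct Rlt_dec; lra.
Qed.

Lemma is_lim_Rabs_qpow (q x : R) :
  0 < q < 1 -> is_lim_seq (fun n => Rabs (q ^ n * x)) 0.
Proof.
intros hq; rewrite <- Rabs_R0.
exact (is_lim_seq_abs _ 0 (is_lim_seq_qpow q hq x)).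
Qed.

(** In the extremal example the Stieltjes integral is 1 and [(M - m) * (b - a)] is 2 with [L = 1],
    so the assumed bound reads [1 <= 2 * c]. *)
Lemma q_gruss_sharp (q c : R) :
  0 < q < 1 ->
  (forall (a b : R) (f u : R -> R) (m M L : R),
     a < 0 < b ->
     abs_q_integrable q f a b ->
     (forall x : R, qlattice q a b x -> m <= f x <= M) ->
     q_lipschitzian q L u a b ->
     ex_qlim q u a ->
     ex_qlim q u b ->
     Rabs (q_stieltjes q f u a b
           - (u b - u a - (qlim q u b - qlim q u a)) / (b - a) * jackson q f a b)
       <= c * L * (M - m) * (b - a)) ->
  1 / 2 <= c.
Proof.
intros hq hc.
assert (lim0 : forall x, qlim q Rabs x = 0)
  by (intros x; unfold qlim; now rewrite (is_lim_seq_unique _ _ (is_lim_Rabs_qpow q x hq))).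
assert (exlim : forall x, ex_qlim q Rabs x)
  by (intros x; exists 0; now apply is_lim_Rabs_qpow).
assert (sb : is_series (stieltjes_term q pos_indicator Rabs 1) 1).
{ apply (is_series_Rext (fun k => q ^ k * 1 - q ^ (k + 1) * 1)).
  - intros k; unfold stieltjes_term.
    rewrite (proj1 (pos_indicator_qpow q k (proj1 hq))).
    rewrite !Rabs_pos_eq by (rewrite Rmult_1_r; apply pow_le; lra); ring.
  - exact (is_series_qstep q hq 1). }
assert (sa : is_series (stieltjes_term q pos_indicator Rabs (-1)) 0).
{ apply (is_series_Rext (fun _ => 0)); [|exact is_series_R0].
  intros k; unfold stieltjes_term.
  rewrite (proj2 (pos_indicator_qpow q k (proj1 hq))); ring. }
specialize (hc (-1) 1 pos_indicator Rabs 0 1 1).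
lapply hc; [clear hc; intros hc|lra].
lapply hc; [clear hc; intros hc|].
2:{ split.
    - exists 0; apply (is_series_Rext (fun _ => 0)); [|exact is_series_R0].
      intros k; unfold jackson_term.
      rewrite (proj2 (pos_indicator_qpow q k (proj1 hq))), Rabs_R0; ring.
    - exists 1; apply (is_series_Rext (fun k => q ^ k * 1 - q ^ (k + 1) * 1)).
      + intros k; unfold jackson_term.
        rewrite (proj1 (pos_indicator_qpow q k (proj1 hq))), Rabs_R1; ring.
      + exact (is_series_qstep q hq 1). }
lapply hc; [clear hc; intros hc|intros x _; unfold pos_indicator; destruct Rlt_dec; lra].
lapply hc; [clear hc; intros hc|].
(* The reverse triangle inequality gives the Lipschitz constant 1. *)
2:{ intros x _; rewrite Rmult_1_l; apply Rabs_triang_inv2. }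
specialize (hc (exlim _) (exlim _)).
unfold q_stieltjes in hc.
rewrite (is_series_unique _ _ sb), (is_series_unique _ _ sa), !lim0 in hc.
replace (Rabs (-1)) with 1 in hc by (rewrite Rabs_left; lra).
rewrite Rabs_R1 in hc.
(* Since [Rabs] is even with both one-sided limits 0, the coefficient of the Jackson integral
   vanishes and its value need not be computed. *)
replace (1 - 0 - (1 - 1 - (0 - 0)) / (1 - -1) * jackson q pos_indicator (-1) 1)
  with 1 in hc by field.
rewrite Rabs_R1 in hc; lra.
Qed.

Theorem corollary4p19 (q : R) (hq : 0 < q < 1) :
  (forall (a b : R) (f u : R -> R) (m M L : R),
     a < 0 < b ->
     abs_q_integrable q f a b ->
     (forall x : R, qlattice q a b x -> m <= f x <= M) ->
     q_lipschitzian q L u a b ->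
     ex_qlim q u a ->
     ex_qlim q u b ->
     q_stieltjes_integrable q f u a b /\
     Rabs (q_stieltjes q f u a b
           - (u b - u a - (qlim q u b - qlim q u a)) / (b - a)
             * jackson q f a b)
       <= 1 / 2 * L * (M - m) * (b - a))
  /\
  ~ (exists c : R, c < 1 / 2 /\
       forall (a b : R) (f u : R -> R) (m M L : R),
         a < 0 < b ->
         abs_q_integrable q f a b ->
         (forall x : R, qlattice q a b x -> m <= f x <= M) ->
         q_lipschitzian q L u a b ->
         ex_qlim q u a ->
         ex_qlim q u b ->
         Rabs (q_stieltjes q f u a b
               - (u b - u a - (qlim q u b - qlim q u a)) / (b - a)
                 * jackson q f a b)
           <= c * L * (M - m) * (b - a)).
Proof.
split.
- intros a b f u m M L; now apply q_gruss.
- intros [c [hc h]]; apply (Rlt_not_le _ _ hc), (q_gruss_sharp q c hq h).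
Qed.
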